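(* Let $P_1, P_2 \in \mathbb{P}$. Then $P_1$ and $P_2$ are brm-forward-reverse bisimilar if and only if for every formula $\phi$ of the backward ready multiset logic $\mathcal{L}_{\mathrm{BRM}}$, $P_1 \models \phi \iff P_2 \models \phi$.
   Context: Fix a countable set $\mathcal{A}$ of actions containing an unobservable action $\tau$. Proof terms: $\theta ::= a \mid ._{a}\theta \mid {+_{\mathrm l}}\theta \mid {+_{\mathrm r}}\theta \mid {\|^{\mathrm l}_{L}}\theta \mid {\|^{\mathrm r}_{L}}\theta \mid \langle\theta,\theta\rangle_L$ with $a \in \mathcal{A}$, $L \subseteq \mathcal{A}\setminus\{\tau\}$. The partial function $\mathrm{act}$ is: $\mathrm{act}(a)=a$; $\mathrm{act}$ of $._a\theta$, ${+_{\mathrm l}}\theta$, ${+_{\mathrm r}}\theta$, ${\|^{\mathrm l}_L}\theta$, ${\|^{\mathrm r}_L}\theta$ is $\mathrm{act}(\theta)$; $\mathrm{act}(\langle\theta_1,\theta_2\rangle_L) = \mathrm{act}(\theta_1)$ if $\mathrm{act}(\theta_1)=\mathrm{act}(\theta_2)$, undefined otherwise. Processes: $P ::= \underline{0} \mid a.P \mid a^{\dagger\xi}.P \mid P + P \mid P \|_L P$ with $\xi ::= \varepsilon \mid \langle\theta,\theta'\rangle_L$ ($a^{\dagger\varepsilon}$ is written $a^\dagger$; $a^{\dagger\xi}$ denotes an already executed action). A process is initial iff it contains no $\dagger$: $\underline{0}$ is initial; $a.P$ is initial iff $P$ is; $P_1+P_2$ and $P_1\|_L P_2$ are initial iff both $P_1,P_2$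 are. Proved transitions $P \xrightarrow{\theta} P'$ are the least relation given by: (Act$_f$) if $P$ initial then $a.P \xrightarrow{a} a^\dagger.P$; (Act$_p$) if $P \xrightarrow{\theta} P'$ then $a^{\dagger\xi}.P \xrightarrow{._a\theta} a^{\dagger\xi}.P'$; (Cho$_l$) if $P_1 \xrightarrow{\theta} P_1'$ and $P_2$ initial then $P_1+P_2 \xrightarrow{+_{\mathrm l}\theta} P_1'+P_2$; (Cho$_r$) symmetrically with $+_{\mathrm r}$ when $P_1$ is initial and $P_2$ moves; (Par$_l$) if $P_1 \xrightarrow{\theta} P_1'$ and $\mathrm{act}(\theta)\notin L$ then $P_1\|_LP_2 \xrightarrow{\|^{\mathrm l}_L\theta} P_1'\|_LP_2$; (Par$_r$) symmetrically with $\|^{\mathrm r}_L$; (Syn) if $P_1 \xrightarrow{\theta_1} P_1'$, $P_2 \xrightarrow{\theta_2} P_2'$ and $\mathrm{act}(\theta_1)=\mathrm{act}(\theta_2)\in L$ then $P_1\|_LP_2 \xrightarrow{\langle\theta_1,\theta_2\rangle_L} \mathrm{enr}(P_1'\|_LP_2', \langle\theta_1,\theta_2\rangle_L)$. Here $\mathrm{enr}(P,\bar\theta)=\mathrm{enr}'(P,\bar\theta,\bar\theta)$ where: $\mathrm{enr}'(\underline 0,\theta,\bar\theta)=\underline 0$; $\mathrm{enr}'(a^{\dagger\xi}.P',a,\bar\theta) = a^{\dagger\bar\theta}.P'$; $\mathrm{enr}'(a^{\dagger\xi}.P',._a\theta',\bar\theta)=a^{\dagger\xi}.\mathrm{enr}'(P',\theta',\bar\theta)$;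 $\mathrm{enr}'(P_1+P_2,+_{\mathrm l}\theta',\bar\theta)=\mathrm{enr}'(P_1,\theta',\bar\theta)+P_2$ and symmetrically for $+_{\mathrm r}$; $\mathrm{enr}'(P_1\|_LP_2,\|^{\mathrm l}_L\theta',\bar\theta)=\mathrm{enr}'(P_1,\theta',\bar\theta)\|_LP_2$ and symmetrically for $\|^{\mathrm r}_L$; $\mathrm{enr}'(P_1\|_LP_2,\langle\theta_1,\theta_2\rangle_L,\bar\theta)=\mathrm{enr}'(P_1,\theta_1,\bar\theta)\|_L\mathrm{enr}'(P_2,\theta_2,\bar\theta)$; undefined otherwise. $\mathbb{P}$ is the set of processes reachable via proved transitions from some initial process. A transition $P \xrightarrow{\theta} P'$ is an outgoing transition of $P$ and an incoming transition of $P'$. Backward ready multiset $\mathrm{brm}(P)$ (multisets over $\mathcal{A}$; $\oplus$ adds multiplicities, $\otimes$ multiplies them; a set is viewed as a multiset with multiplicity 1; $\overline{L}=\mathcal{A}\setminus L$): $\mathrm{brm}(\underline 0)=\mathrm{brm}(a.P')=\emptyset$; $\mathrm{brm}(a^{\dagger\xi}.P') = \{\!|a|\!\}$ if $P'$ initial, $\mathrm{brm}(P')$ otherwise; $\mathrm{brm}(P_1+P_2)$ is $\emptyset$ if both are initial, $\mathrm{brm}(P_1)$ if only $P_2$ is initial, $\mathrm{brm}(P_2)$ if only $P_1$ is initial; $\mathrm{brm}(P_1\|_LP_2) = (\mathrm{brm}(P_1)\otimes\overline L)\oplus(\mathrm{brm}(P_2)\otimes\overline L)\oplus(\mathrm{brm}(P_1)\otimes\mathrm{brm}(P_2)\otimes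 L)$. $P_1,P_2$ are brm-forward-reverse bisimilar iff they are related by a symmetric relation $\mathcal{B}$ over $\mathbb{P}$ such that whenever $(Q_1,Q_2)\in\mathcal{B}$: for each $Q_1 \xrightarrow{\theta_1} Q_1'$ there is $Q_2 \xrightarrow{\theta_2} Q_2'$ with $\mathrm{act}(\theta_1)=\mathrm{act}(\theta_2)$ and $(Q_1',Q_2')\in\mathcal{B}$; for each $Q_1' \xrightarrow{\theta_1} Q_1$ there is $Q_2' \xrightarrow{\theta_2} Q_2$ with $\mathrm{act}(\theta_1)=\mathrm{act}(\theta_2)$ and $(Q_1',Q_2')\in\mathcal{B}$; and $\mathrm{brm}(Q_1)=\mathrm{brm}(Q_2)$. Backward ready multiset logic $\mathcal{L}_{\mathrm{BRM}}$: $\phi ::= \mathrm{true} \mid M \mid \neg\phi \mid \phi\wedge\phi \mid \langle a\rangle\phi \mid \langle a^\dagger\rangle\phi$ with $M:\mathcal{A}\to\mathbb{N}$, $a\in\mathcal{A}$. Satisfaction over $\mathbb{P}$: $P\models\mathrm{true}$; $P\models M$ iff $\mathrm{brm}(P)=M$; negation and conjunction as usual; $P\models\langle a\rangle\phi'$ iff there is $P\xrightarrow{\theta}P'$ with $\mathrm{act}(\theta)=a$ and $P'\models\phi'$; $P\models\langle a^\dagger\rangle\phi'$ iff there is $P'\xrightarrow{\theta}P$ with $\mathrm{act}(\theta)=a$ and $P'\models\phi'$. *)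

(* Defs.v *)
From HB Require Import structures.
From mathcomp Require Import all_boot.
From mathcomp Require Import boolp classical_sets.

Set Implicit Arguments.
Unset Strict Implicit.
Unset Printing Implicit Defensive.

Local Open Scope classical_set_scope.

Section Calculus.

Variables (A : countType) (tau : A).

(* Arbitrary, possibly infinite, subsets of A not containing tau.  The
   equality test [==] on [syncset] is the classical one from [boolp]. *)
Definition syncset := {L : set A | tau \notin L}.

Implicit Types (a b : A) (L : syncset).

Inductive proof_term : Type :=
| TAct of A                                      (* a               *)
| TPre of A & proof_term                         (* ._a t           *)
| TPlusl of proof_term                           (* +_l t           *)
| TPlusr of proof_term                           (* +_r t           *)
| TParl of syncset & proof_term                  (* ||^l_L t        *)
| TParr of syncset & proof_term                  (* ||^r_L t        *)
| TSync of syncset & proof_term & proof_term.    (* <t1, t2>_L      *)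

Fixpoint act (t : proof_term) : option A :=
  match t with
  | TAct a => Some a
  | TPre _ t' | TPlusl t' | TPlusr t' | TParl _ t' | TParr _ t' => act t'
  | TSync _ t1 t2 => if act t1 == act t2 then act t1 else None
  end.

Inductive xi : Type :=
| XEps
| XSync of syncset & proof_term & proof_term.

Inductive process : Type :=
| Nil                                            (* 0               *)
| Pre of A & process                             (* a.P             *)
| Done of A & xi & process                       (* a^{dagger xi}.P *)
| Plus of process & process                      (* P1 + P2         *)
| Par of syncset & process & process.            (* P1 ||_L P2      *)

Fixpoint initial (P : process) : bool :=
  match P with
  | Nil => true
  | Pre _ P' => initial P'
  | Done _ _ _ => false
  | Plus P1 P2 | Par _ P1 P2 => initial P1 && initial P2
  end.

(* [None] means undefined.  The third argument, which is written into the
   process, is a [xi] because only terms <t1, t2>_L may decorate a dagger. *)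
Fixpoint enr' (P : process) (t : proof_term) (x : xi) : option process :=
  match P, t with
  | Nil, _ => Some Nil
  | Done a y P', TAct b =>
      if a == b then Some (Done a x P') else None
  | Done a y P', TPre b t' =>
      if a == b then omap (Done a y) (enr' P' t' x) else None
  | Plus P1 P2, TPlusl t' => omap (Plus^~ P2) (enr' P1 t' x)
  | Plus P1 P2, TPlusr t' => omap (Plus P1) (enr' P2 t' x)
  | Par L P1 P2, TParl L' t' =>
      if L == L' then omap (Par L ^~ P2) (enr' P1 t' x) else None
  | Par L P1 P2, TParr L' t' =>
      if L == L' then omap (Par L P1) (enr' P2 t' x) else None
  | Par L P1 P2, TSync L' t1 t2 =>
      if L == L' then
        obind (fun P1' => omap (Par L P1') (enr' P2 t2 x)) (enr' P1 t1 x)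
      else None
  | _, _ => None
  end.

Definition enr (P : process) (t : proof_term) : option process :=
  match t with
  | TSync L t1 t2 => enr' P t (XSync L t1 t2)
  | _ => None
  end.

Inductive trans : process -> proof_term -> process -> Prop :=
| Act_f a P of initial P :
    trans (Pre a P) (TAct a) (Done a XEps P)
| Act_p a x P t P' of trans P t P' :
    trans (Done a x P) (TPre a t) (Done a x P')
| Cho_l P1 P2 t P1' of trans P1 t P1' & initial P2 :
    trans (Plus P1 P2) (TPlusl t) (Plus P1' P2)
| Cho_r P1 P2 t P2' of trans P2 t P2' & initial P1 :
    trans (Plus P1 P2) (TPlusr t) (Plus P1 P2')
| Par_l L P1 P2 t P1' a of
    trans P1 t P1' & act t = Some a & a \notin sval L :
    trans (Par L P1 P2) (TParl L t) (Par L P1' P2)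
| Par_r L P1 P2 t P2' a of
    trans P2 t P2' & act t = Some a & a \notin sval L :
    trans (Par L P1 P2) (TParr L t) (Par L P1 P2')
| Syn L P1 P2 t1 t2 P1' P2' a Q of
    trans P1 t1 P1' & trans P2 t2 P2' &
    act t1 = Some a & act t2 = Some a & a \in sval L &
    enr (Par L P1' P2') (TSync L t1 t2) = Some Q :
    trans (Par L P1 P2) (TSync L t1 t2) Q.

Inductive reachable : process -> Prop :=
| reachable_init P of initial P : reachable P
| reachable_trans P t P' of reachable P & trans P t P' : reachable P'.

Definition PP := {P : process | reachable P}.

Definition ptrans (P : PP) (t : proof_term) (P' : PP) : Prop :=
  trans (sval P) t (sval P').

Definition multiset := A -> nat.

Definition mempty : multiset := fun _ => 0.
Definition msing a : multiset := fun b => (b == a : nat).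
Definition mset (S : set A) : multiset := fun b => (b \in S : nat).
Definition madd (M N : multiset) : multiset := fun b => M b + N b.
Definition mmul (M N : multiset) : multiset := fun b => M b * N b.

(* The case of a sum of two non-initial processes, which are not reachable,
   is a dummy value. *)
Fixpoint brm (P : process) : multiset :=
  match P with
  | Nil => mempty
  | Pre _ _ => mempty
  | Done a _ P' => if initial P' then msing a else brm P'
  | Plus P1 P2 =>
      match initial P1, initial P2 with
      | true, true => mempty
      | false, true => brm P1
      | true, false => brm P2
      | false, false => mempty
      end
  | Par L P1 P2 =>
      madd (madd (mmul (brm P1) (mset (~` sval L)))
                 (mmul (brm P2) (mset (~` sval L))))
           (mmul (mmul (brm P1) (brm P2)) (mset (sval L)))
  end.

Definition brm_fr_bisimulation (B : PP -> PP -> Prop) : Prop :=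
  (forall Q1 Q2, B Q1 Q2 -> B Q2 Q1) /\
  (forall Q1 Q2, B Q1 Q2 ->
     [/\ (forall t1 Q1', ptrans Q1 t1 Q1' ->
            exists t2 Q2', [/\ ptrans Q2 t2 Q2', act t1 = act t2 & B Q1' Q2']),
         (forall t1 Q1', ptrans Q1' t1 Q1 ->
            exists t2 Q2', [/\ ptrans Q2' t2 Q2, act t1 = act t2 & B Q1' Q2'])
       & brm (sval Q1) = brm (sval Q2)]).

Definition brm_fr_bisimilar (P1 P2 : PP) : Prop :=
  exists B : PP -> PP -> Prop, brm_fr_bisimulation B /\ B P1 P2.

Inductive formula : Type :=
| FTrue
| FMset of multiset
| FNot of formula
| FAnd of formula & formula
| FDia of A & formula                            (* <a> phi         *)
| FDiaDag of A & formula.                        (* <a^dagger> phi  *)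

Fixpoint sat (P : PP) (phi : formula) : Prop :=
  match phi with
  | FTrue => True
  | FMset M => brm (sval P) = M
  | FNot phi' => ~ sat P phi'
  | FAnd phi1 phi2 => sat P phi1 /\ sat P phi2
  | FDia a phi' =>
      exists t P', [/\ ptrans P t P', act t = Some a & sat P' phi']
  | FDiaDag a phi' =>
      exists t P', [/\ ptrans P' t P, act t = Some a & sat P' phi']
  end.

End Calculus.

Arguments FTrue {A}.

(* Main.v *)
(* Bisimilar processes satisfy the same formulas by induction on the formula.
   The converse is the Hennessy-Milner argument, which needs finitely many
   successors and finitely many predecessors.  The delicate part is the
   predecessors: a synchronization overwrites the decorations of the actions
   that it executes, so the intermediate results P1', P2' of its premises cannot
   be read off from its target.  However, the source of a transition never
   depends on the decoration of the action being executed, so transitions are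
   relaxed to allow any decoration there; the relaxed relation is structural and
   hence finitely branching backward. *)
Require Import Defs.
From HB Require Import structures.
From mathcomp Require Import all_boot.
From mathcomp Require Import boolp classical_sets cardinality.

Set Implicit Arguments.
Unset Strict Implicit.
Unset Printing Implicit Defensive.

Local Open Scope classical_set_scope.

Section ImageFiniteness.

Variables (A : countType) (tau : A).

Implicit Types (P Q : process tau) (t : proof_term tau) (x : xi tau).

(** The modalities are indexed by actions, so a transition is visible to the logic only if its label
    is defined. Only synchronization could fail here, and its premises force both labels to be the
    same action. *)
Lemma trans_act P t Q : trans P t Q -> exists a, act t = Some a.
Proof.
elim=> //=; first by move=> a *; exists a.
by move=> ? ? ? ? ? ? ? a ? _ _ _ _ -> -> *; exists a; rewrite eqxx.
Qed.

(** Proof terms are kept with the targets because the target of a synchronization depends on the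
    proof terms of its premises, which [enr] writes into it. *)
Lemma finite_successors P : finite_set [set tQ | trans P tQ.1 tQ.2].
Proof.
elim: P => [|a P _|a x P IHP|P1 IH1 P2 IH2|L P1 IH1 P2 IH2].
- by apply: sub_finite_set (@finite_set0 _) => -[t Q] /= H; inversion H.
- apply: sub_finite_set (finite_set1 (TAct tau a, Done a (XEps tau) P)).
  by move=> [t Q] /= H; inversion H.
- apply: sub_finite_set
    (finite_image (fun tQ => (TPre a tQ.1, Done a x tQ.2)) IHP).
  move=> [t Q] /= H; inversion H as [|? ? ? t' Q' H'| | | | |]; subst.
  by exists (t', Q').
- apply: (@sub_finite_set _ _
    ([set (TPlusl tQ.1, Plus tQ.2 P2) | tQ in [set tQ | trans P1 tQ.1 tQ.2]] `|`
     [set (TPlusr tQ.1, Plus P1 tQ.2) | tQ in [set tQ | trans P2 tQ.1 tQ.2]])).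
    move=> [t Q] /= H.
    inversion H as [| |? ? t' Q' H'|? ? t' Q' H'| | |]; subst.
      by left; exists (t', Q').
    by right; exists (t', Q').
  by rewrite finite_setU; split; apply: finite_image.
(* The default [u.2] makes [sync] total and is never reached: the premise of [Syn] says that [enr]
   is defined. *)
- pose sync (u v : proof_term tau * process tau) :=
    let t := TSync L u.1 v.1 in
    (t, odflt u.2 (enr (Par L u.2 v.2) t)).
  apply: (@sub_finite_set _ _
    ([set (TParl L tQ.1, Par L tQ.2 P2) | tQ in [set tQ | trans P1 tQ.1 tQ.2]] `|`
     [set (TParr L tQ.1, Par L P1 tQ.2) | tQ in [set tQ | trans P2 tQ.1 tQ.2]] `|`
     [set sync u v | u in [set tQ | trans P1 tQ.1 tQ.2] &
                     v in [set tQ | trans P2 tQ.1 tQ.2]])).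
    move=> [t Q] /= H.
    inversion H as [| | | |? ? ? t' Q' ? H'|? ? ? t' Q' ? H'
                   |? ? ? t1 t2 Q1 Q2 ? ? H1 H2 ? ? ? E]; subst.
    + by left; left; exists (t', Q').
    + by left; right; exists (t', Q').
    + right; exists (t1, Q1) => //; exists (t2, Q2) => //.
      by rewrite /sync /fst /snd E.
  by rewrite !finite_setU; do !split;
    [exact: finite_image | exact: finite_image | exact: finite_image2].
Qed.

(* [trans], except that the executed actions get arbitrary decorations and side
   conditions are dropped. *)
Inductive relaxed_trans : process tau -> proof_term tau -> process tau -> Prop :=
| relaxed_act a x P : relaxed_trans (Pre a P) (TAct tau a) (Done a x P)
| relaxed_pre a x P t Q of relaxed_trans P t Q :
    relaxed_trans (Done a x P) (TPre a t) (Done a x Q)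
| relaxed_plusl P1 P2 t Q1 of relaxed_trans P1 t Q1 :
    relaxed_trans (Plus P1 P2) (TPlusl t) (Plus Q1 P2)
| relaxed_plusr P1 P2 t Q2 of relaxed_trans P2 t Q2 :
    relaxed_trans (Plus P1 P2) (TPlusr t) (Plus P1 Q2)
| relaxed_parl L P1 P2 t Q1 of relaxed_trans P1 t Q1 :
    relaxed_trans (Par L P1 P2) (TParl L t) (Par L Q1 P2)
| relaxed_parr L P1 P2 t Q2 of relaxed_trans P2 t Q2 :
    relaxed_trans (Par L P1 P2) (TParr L t) (Par L P1 Q2)
| relaxed_sync L P1 P2 t1 t2 Q1 Q2 of
    relaxed_trans P1 t1 Q1 & relaxed_trans P2 t2 Q2 :
    relaxed_trans (Par L P1 P2) (TSync L t1 t2) (Par L Q1 Q2).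

(** Following [t], [enr'] redecorates exactly the actions that the transition has just executed, and
    there [relaxed_act] accepts any decoration. *)
Lemma relaxed_trans_enr' P t Q x Q' :
  relaxed_trans P t Q -> enr' Q t x = Some Q' -> relaxed_trans P t Q'.
Proof.
move=> H; elim: H Q' => {P t Q} /=.
- by move=> a y P Q'; rewrite eqxx => -[<-]; constructor.
- move=> a y P t Q _ IH Q'; rewrite eqxx.
  by case E: enr' => [R|] //= -[<-]; constructor; apply: IH.
- by move=> P1 P2 t Q _ IH Q'; case E: enr' => [R|] //= -[<-];
    constructor; apply: IH.
- by move=> P1 P2 t Q _ IH Q'; case E: enr' => [R|] //= -[<-];
    constructor; apply: IH.
- move=> L P1 P2 t Q _ IH Q'; rewrite eqxx.
  by case E: enr' => [R|] //= -[<-]; constructor; apply: IH.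
- move=> L P1 P2 t Q _ IH Q'; rewrite eqxx.
  by case E: enr' => [R|] //= -[<-]; constructor; apply: IH.
- move=> L P1 P2 t1 t2 Q1 Q2 _ IH1 _ IH2 Q'; rewrite eqxx.
  case E1: enr' => [R1|] //=; case E2: enr' => [R2|] //= -[<-].
  by constructor; [apply: IH1 | apply: IH2].
Qed.

Lemma trans_relaxed P t Q : trans P t Q -> relaxed_trans P t Q.
Proof.
elim=> {P t Q}; try by move=> *; constructor.
move=> L P1 P2 t1 t2 Q1 Q2 a Q _ H1 _ H2 _ _ _.
exact/relaxed_trans_enr'/relaxed_sync.
Qed.

Lemma finite_predecessors Q : finite_set [set P | exists t, trans P t Q].
Proof.
apply: (@sub_finite_set _ _ [set P | exists t, relaxed_trans P t Q]).
  by move=> P [t /trans_relaxed]; exists t.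
elim: Q => [|a Q _|a x Q IHQ|Q1 IH1 Q2 IH2|L Q1 IH1 Q2 IH2].
- by apply: sub_finite_set (@finite_set0 _) => P [t H]; inversion H.
- by apply: sub_finite_set (@finite_set0 _) => P [t H]; inversion H.
(* Either the head action is the one being undone, or it was executed earlier and the undoing takes
   place below it. *)
- apply: (@sub_finite_set _ _ ([set Pre a Q] `|`
    Done a x @` [set P | exists t, relaxed_trans P t Q])).
    move=> P [t H].
    inversion H as [|? ? P' t' ? H'| | | | |]; subst; first by left.
    by right; exists P' => //; exists t'.
  by rewrite finite_setU; split; [exact: finite_set1 | exact: finite_image].
- apply: (@sub_finite_set _ _
    ([set Plus P Q2 | P in [set P | exists t, relaxed_trans P t Q1]] `|`
     [set Plus Q1 P | P in [set P | exists t, relaxed_trans P t Q2]])).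
    move=> P [t H].
    inversion H as [| |P1 ? t' ? H'|? P2 t' ? H'| | |]; subst.
      by left; exists P1 => //; exists t'.
    by right; exists P2 => //; exists t'.
  by rewrite finite_setU; split; apply: finite_image.
- apply: (@sub_finite_set _ _
    ([set Par L P Q2 | P in [set P | exists t, relaxed_trans P t Q1]] `|`
     [set Par L Q1 P | P in [set P | exists t, relaxed_trans P t Q2]] `|`
     [set Par L X Y | X in [set P | exists t, relaxed_trans P t Q1] &
                      Y in [set P | exists t, relaxed_trans P t Q2]])).
    move=> P [t H].
    inversion H as [| | | |? P1 ? t' ? H'|? ? P2 t' ? H'
                   |? P1 P2 t1 t2 ? ? H1 H2]; subst.
    + by left; left; exists P1 => //; exists t'.
    + by left; right; exists P2 => //; exists t'.
    + by right; exists P1; [exists t1 | exists P2 => //; exists t2].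
  by rewrite !finite_setU; do !split;
    [exact: finite_image | exact: finite_image | exact: finite_image2].
Qed.

End ImageFiniteness.

Definition logically_equivalent (A : countType) (tau : A) (P Q : PP tau) :=
  forall phi : formula A, sat P phi <-> sat Q phi.

(** A finite conjunction with one conjunct for each element of [S] that is inequivalent to [P]. *)
Lemma separating_formula (A : countType) (tau : A) (P : PP tau)
    (S : set (process tau)) :
  finite_set S ->
  exists2 phi, sat P phi &
    forall Q : PP tau, S (sval Q) -> sat Q phi -> logically_equivalent P Q.
Proof.
move=> /(@finite_seqP {classic process tau})[s ->].
elim: s => [|R s [phi Pphi phis]]; first by exists FTrue.
have [[Q [QR]]|noQ] :=
    pselect (exists Q : PP tau, sval Q = R /\ ~ logically_equivalent P Q).
  move=> /existsNP[psi PQpsi].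
  (* Closure under negation lets the distinguishing formula be chosen true at [P]. *)
  have [chi Pchi Qchi] : exists2 chi, sat P chi & ~ sat Q chi.
    have [Ppsi|nPpsi] := pselect (sat P psi); first by exists psi => //; tauto.
    by exists (FNot psi) => //=; tauto.
  exists (FAnd phi chi) => // Q' /=.
  rewrite inE => /orP[/eqP Q'R [_ Q'chi]|Q's [Q'phi _]]; last exact: phis.
  (* Reachability proofs are irrelevant, so a single conjunct handles everything lying over [R]. *)
  suff Q'Q : Q' = Q by rewrite Q'Q in Q'chi.
  by apply: eq_sig_hprop; [move=> ? ? ?; exact: Prop_irrelevance|rewrite QR].
exists phi => // Q /=; rewrite inE => /orP[/eqP QR _|]; last exact: phis.
by apply: contrapT => PQ; apply: noQ; exists Q.
Qed.

(** One implication suffices for the induction: symmetry of [B] reverses it in the negation case. *)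
Lemma bisimulation_sat (A : countType) (tau : A) (B : PP tau -> PP tau -> Prop)
    (phi : formula A) (P Q : PP tau) :
  brm_fr_bisimulation B -> B P Q -> sat P phi -> sat Q phi.
Proof.
move=> [symB bisB].
elim: phi P Q => [|M|phi IH|phi IH1 psi IH2|a phi IH|a phi IH] P Q BPQ //=.
- by have [_ _ ->] := bisB _ _ BPQ.
- by move=> nP Qphi; apply: nP; apply: IH Qphi; exact: symB.
- by move=> [/(IH1 _ _ BPQ) ? /(IH2 _ _ BPQ) ?].
- have [fwd _ _] := bisB _ _ BPQ.
  move=> [t [P' [/fwd[t' [Q' [QQ' -> BPQ']]] ta P'phi]]].
  by exists t', Q'; split=> //; exact: IH P'phi.
- have [_ bwd _] := bisB _ _ BPQ.
  move=> [t [P' [/bwd[t' [Q' [QQ' -> BPQ']]] ta P'phi]]].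
  by exists t', Q'; split=> //; exact: IH P'phi.
Qed.

(** To match a move to [P'], take a formula separating [P'] from all inequivalent candidates around
    [Q], whatever their labels. Under the modality for the action of the move it holds at [P], hence
    at [Q], and its witness there must be equivalent to [P']. *)
Lemma logically_equivalent_bisimulation (A : countType) (tau : A) :
  brm_fr_bisimulation (@logically_equivalent A tau).
Proof.
split=> [P Q PQ phi|P Q PQ]; first by split=> /PQ.
split=> [t P' PP'|t P' PP'|].
- have [a ta] := trans_act PP'.
  have [phi P'phi sep] := separating_formula P'
    (finite_image snd (finite_successors (sval Q))).
  have /PQ /= [t' [Q' [QQ' t'a Q'phi]]] : sat P (FDia a phi) by exists t, P'.
  exists t', Q'; split; [by []|by rewrite ta|apply: sep => //].
  by exists (t', sval Q').
- have [a ta] := trans_act PP'.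
  have [phi P'phi sep] := separating_formula P' (finite_predecessors (sval Q)).
  have /PQ /= [t' [Q' [QQ' t'a Q'phi]]] : sat P (FDiaDag a phi) by exists t, P'.
  exists t', Q'; split; [by []|by rewrite ta|apply: sep => //].
  by exists t'.
- by have /PQ /= : sat P (FMset (brm (sval P))) by [].
Qed.

Theorem theorem4p6 (A : countType) (tau : A) (P1 P2 : PP tau) :
  brm_fr_bisimilar P1 P2 <->
  (forall phi : formula A, sat P1 phi <-> sat P2 phi).
Proof.
split=> [[B [bisB BP]] phi|equivP].
  split; apply: bisimulation_sat (bisB) _ => //.
  by have [symB _] := bisB; exact: symB.
exists (@logically_equivalent A tau); split=> //.
exact: logically_equivalent_bisimulation.
Qed.
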